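(* Let $K$ be a finite set with $|K|\ge2$ and $C,D$ nonempty countable sets. Suppose that $u,v\in\Delta(K\times C\times D)$ are two information structures with conditionally independent information (i.e. under each of $u$ and $v$, the signals $c$ and $d$ are conditionally independent given $k$) such that $\mathrm{marg}_{K\times D}u=\mathrm{marg}_{K\times D}v$. Then $d(u,v)=d_1(u,v)$.
   Context: An information structure is a probability on triples $(k,c,d)$ with countably many signals; $k$ is the state, $c$ the signal of player 1 (maximizer), $d$ the signal of player 2 (minimizer). A payoff function is a map $g:K\times I\times J\to[-1,1]$ with $I,J$ finite nonempty sets; $\mathcal G$ is the set of all payoff functions and $\mathcal G_1\subset\mathcal G$ is the set of those for which $J$ is a singleton (player 1 single-agent problems). $\mathrm{val}(u,g)$ is the value of the zero-sum Bayesian game in which $(k,c,d)\sim u$, player 1 learns $c$, player 2 learns $d$, they simultaneously choose $i\in I$, $j\in J$ (mixed actions depending on own signal allowed), and player 1 receives $g(k,i,j)$ from player 2. $d(u,v)=\sup_{g\in\mathcal G}|\mathrm{val}(u,g)-\mathrm{val}(v,g)|$ and $d_1(u,v)=\sup_{g\in\mathcal G_1}|\mathrm{val}(u,g)-\mathrm{val}(v,g)|$. $\mathrm{marg}$ denotes marginal distributions. *)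

(* Defs.v *)
From mathcomp Require Import all_boot all_order all_algebra.
From mathcomp Require Import all_classical all_reals all_analysis.

Set Implicit Arguments.
Unset Strict Implicit.
Unset Printing Implicit Defensive.

Import Order.TTheory GRing.Theory Num.Theory.
Local Open Scope classical_set_scope.
Local Open Scope ring_scope.

(* Delta(X) for X countable: a probability is given by its mass function.
   A finType is a countType, so this also serves for mixed actions. *)
Record dist (R : realType) (X : countType) := Dist {
  mass :> X -> R;
  mass_ge0 : forall x, 0 <= mass x;
  mass_sum1 : (\esum_(x in [set: X]) (mass x)%:E = 1)%E }.

(* Since \esum is only meaningful for nonnegative families, the expectation is
   the difference of the sums of the positive and negative parts; both are
   finite when f is bounded. *)
Definition expect (R : realType) (X : countType) (u : dist R X) (f : X -> R) : R :=
  let a := fun x => (u x * f x)%:E in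
  fine (\esum_(x in [set: X]) (a^\+)%E x - \esum_(x in [set: X]) (a^\-)%E x)%E.

(* The mass function of the image of u under p; marginals are the case where p
   is a coordinate projection. *)
Definition marg (R : realType) (X Y : countType) (p : X -> Y) (u : dist R X)
    (y : Y) : R :=
  fine (\esum_(x in p @^-1` [set y]) (u x)%:E)%E.

Section InformationStructures.
Variables (R : realType) (K : finType) (C D : countType).

Definition info_structure := dist R (K * C * D)%type.

Definition margK : info_structure -> K -> R := marg (fun w => w.1.1).
Definition margKC : info_structure -> K * C -> R := marg (fun w => w.1).
Definition margKD : info_structure -> K * D -> R :=
  marg (fun w => (w.1.1, w.2)).

(* P(c, d | k) = P(c | k) P(d | k) whenever P(k) > 0. *)
Definition cond_indep (u : info_structure) : Prop :=
  forall k, 0 < margK u k -> forall c d,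
    u (k, c, d) / margK u k =
    (margKC u (k, c) / margK u k) * (margKD u (k, d) / margK u k).

Section Game.
Variables (I J : finType).

(* Expected payoff when player 1 uses s and player 2 uses t. *)
Definition exp_payoff (u : info_structure) (g : K -> I -> J -> R)
    (s : C -> dist R I) (t : D -> dist R J) : R :=
  expect u (fun w =>
    \sum_(i : I) \sum_(j : J) s w.1.2 i * t w.2 j * g w.1.1 i j).

Definition maxmin (u : info_structure) (g : K -> I -> J -> R) : \bar R :=
  ereal_sup (range (fun s : C -> dist R I =>
    ereal_inf (range (fun t : D -> dist R J => (exp_payoff u g s t)%:E)))).

Definition minmax (u : info_structure) (g : K -> I -> J -> R) : \bar R :=
  ereal_inf (range (fun t : D -> dist R J =>
    ereal_sup (range (fun s : C -> dist R I => (exp_payoff u g s t)%:E)))).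

(* The value is the common value of maxmin and minmax; it exists for I and J
   nonempty and g bounded, by the minimax theorem. *)
Definition value (u : info_structure) (g : K -> I -> J -> R) : R :=
  xget 0 [set x : R | maxmin u g = x%:E /\ minmax u g = x%:E].

Definition payoffs : set (K -> I -> J -> R) :=
  [set g | [/\ (0 < #|I|)%N, (0 < #|J|)%N &
              forall k i j, -1 <= g k i j <= 1]].

Definition payoffs1 : set (K -> I -> J -> R) :=
  [set g | payoffs g /\ #|J| = 1%N].

End Game.

Definition dist_over (G : forall I J : finType, set (K -> I -> J -> R))
    (u v : info_structure) : \bar R :=
  ereal_sup [set x | exists (I J : finType) (g : K -> I -> J -> R),
    G I J g /\ x = (`|value u g - value v g|)%:E].

Definition d_val : info_structure -> info_structure -> \bar R :=
  dist_over payoffs.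

Definition d1_val : info_structure -> info_structure -> \bar R :=
  dist_over payoffs1.

End InformationStructures.

(* Main.v *)
Require Import Defs.
From mathcomp Require Import all_boot all_order all_algebra.
From mathcomp Require Import all_classical all_reals all_analysis.
From mathcomp Require Import ring lra.

Set Implicit Arguments.
Unset Strict Implicit.
Unset Printing Implicit Defensive.

Import Order.TTheory GRing.Theory Num.Theory.
Local Open Scope classical_set_scope.
Local Open Scope ring_scope.

(** The value of a game is also its minmax.  Under conditional independence,
    fix a strategy [t] of player 2: player 1, knowing only that [d] is drawn
    from P(d | k), faces a single-agent problem with payoff
<<
      G_t(k, i) = sum_d P(d | k) sum_j t(d)(j) g(k, i, j),
>>
    which depends on the information structure only through its marginal on
    [K * D].  So [u] and [v] lead to the same family of problems [G_t]
    ([reduced], [reduced_payoff], [reduced_eq]), the best replies to [t] under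
    [u] and under [v] are worth the same up to [d1], and taking the infimum
    over [t] shows that the two minmax values, hence the two values, differ by
    at most [d1] ([value_le]).  The other inequality is an inclusion of
    suprema.

    The argument needs the value to exist for games with countably many
    signals.  Conditional independence makes the payoff an inner product in
    the finite-dimensional space of functions on [K * J]: player 1 matters only
    through the joint law of state and action that he induces, and likewise
    player 2 ([joint], [exp_payoffE]).  These laws form bounded convex sets, and
    [minimax] holds for the inner product on bounded convex sets, closed or
    not.  Boundedness reduces it to finitely many strategies of player 2
    ([finite_net]); then the squared shortfall of player 1 against those, summed,
    has infimum 0, because moving slightly towards a best reply to the mixture
    of the net weighted by the current shortfalls would decrease it otherwise
    ([maxmin_finite]). *)

(** * Sums over countable types, and marginals *)

Section Sums.
Variable R : realType.

Lemma esum_mull (X : choiceType) (A : set X) (r : R) (a : X -> \bar R) :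
  0 <= r -> (forall x, 0 <= a x)%E ->
  (\esum_(x in A) (r%:E * a x) = r%:E * \esum_(x in A) a x)%E.
Proof.
move=> r0 a0; rewrite /esum -ereal_supZl//.
  congr ereal_sup; rewrite image_comp/=.
  by apply: eq_imagel => B _; rewrite /= ge0_mule_fsumr.
apply/set0P; exists (\sum_(x \in set0) a x)%E, set0 => //; exact: fsets_set0.
Qed.

Lemma esum_fin (X : finType) (f : X -> \bar R) : (forall x, 0 <= f x)%E ->
  (\esum_(x in [set: X]) f x = \sum_x f x)%E.
Proof.
move=> f0; rewrite esum_fset//; last exact: finite_finset.
have -> : [set: X] = [set` enum X].
  by apply/seteqP; split=> x //= _; rewrite mem_enum.
by rewrite -fsbig_seq ?enum_uniq//= big_enum.
Qed.

Definition nnsummable (X : choiceType) (f : X -> R) :=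
  (forall x, 0 <= f x) /\ (\esum_(x in [set: X]) (f x)%:E < +oo)%E.

Definition tsum (X : choiceType) (f : X -> R) : R :=
  fine (\esum_(x in [set: X]) (f x)%:E).

Lemma tsum_ge0 (X : choiceType) (f : X -> R) : (forall x, 0 <= f x) -> 0 <= tsum f.
Proof. by move=> f0; apply/fine_ge0/esum_ge0 => x _; rewrite lee_fin. Qed.

Lemma tsumE (X : choiceType) (f : X -> R) : nnsummable f ->
  (\esum_(x in [set: X]) (f x)%:E = (tsum f)%:E)%E.
Proof.
move=> [f0 foo]; rewrite fineK// ge0_fin_numE//.
by apply: esum_ge0 => x _; rewrite lee_fin.
Qed.

Lemma nnsummable_le (X : choiceType) (f g : X -> R) :
  nnsummable g -> (forall x, 0 <= f x <= g x) -> nnsummable f.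
Proof.
move=> [g0 goo] fg; split=> [x|]; first by case/andP: (fg x).
apply: le_lt_trans goo; apply: le_esum => x _.
by rewrite lee_fin; case/andP: (fg x).
Qed.

Lemma esum_lin (X : choiceType) (Q : finType) (w : Q -> R) (f : Q -> X -> R) :
  (forall q, 0 <= w q) -> (forall q, nnsummable (f q)) ->
  (\esum_(x in [set: X]) (\sum_q w q * f q x)%:E =
   (\sum_q w q * tsum (f q))%:E)%E.
Proof.
move=> w0 fs; under eq_esum do rewrite -sumEFin.
have f0 q x : 0 <= f q x by case: (fs q).
rewrite esum_sum => [|x q _ _]; last by rewrite lee_fin mulr_ge0.
rewrite -sumEFin; apply: eq_bigr => q _.
under eq_esum do rewrite EFinM.
by rewrite esum_mull ?tsumE// => x; rewrite lee_fin.
Qed.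

Lemma tsum_lin (X : choiceType) (Q : finType) (w : Q -> R) (f : Q -> X -> R) :
  (forall q, 0 <= w q) -> (forall q, nnsummable (f q)) ->
  tsum (fun x => \sum_q w q * f q x) = \sum_q w q * tsum (f q).
Proof. by move=> w0 fs; rewrite {1}/tsum esum_lin. Qed.

Lemma esum_mul (X Y : choiceType) (f : X -> R) (h : Y -> R) :
  nnsummable f -> nnsummable h ->
  (\esum_(z in [set: X * Y]) (f z.1 * h z.2)%:E = (tsum f * tsum h)%:E)%E.
Proof.
move=> fs hs; have [f0 _] := fs; have [h0 _] := hs.
have -> : [set: X * Y] = [set: X] `*`` (fun=> [set: Y]).
  by apply/seteqP; split.
rewrite -(@esum_esum _ _ _ _ _ (fun x y => (f x * h y)%:E)) => [|x y _ _]; last first.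
  by rewrite lee_fin mulr_ge0.
under eq_esum => x _.
  under eq_esum do rewrite EFinM.
  rewrite esum_mull ?tsumE//.
  rewrite muleC; over.
rewrite esum_mull ?tsumE// ?tsum_ge0//.
by rewrite -EFinM mulrC.
Qed.

Section Dist.
Variable X : countType.

(** Each point of the preimage of [A] lies in exactly one fibre, so the sum of
    the masses splits along fibres; finiteness of the total mass makes the
    [fine] in [marg] harmless. *)
Lemma marg_fiber (Y : countType) (p : X -> Y) (u : dist R X) (A : set Y) :
  (\esum_(y in A) (marg p u y)%:E = \esum_(x in p @^-1` A) (u x)%:E)%E.
Proof.
have u0 x : (0 <= (u x)%:E)%E by rewrite lee_fin mass_ge0.
transitivity (\esum_(y in A) \esum_(x in p @^-1` [set y]) (u x)%:E)%E.
  apply: eq_esum => y Ay; rewrite /marg fineK// ge0_fin_numE ?esum_ge0//.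
  apply: (@le_lt_trans _ _ 1%E); last exact: ltry.
  rewrite -(mass_sum1 u) esum_mkcond; apply: le_esum => x _; by case: ifP.
rewrite esum_esum//; apply: (@reindex_esum _ _ _ _ _ (fun x => (p x, x))).
split=> [x Ax|x y _ _ [_ ->]//|[y x] [/= Ay pxy]]; first by [].
by exists x; rewrite /preimage /= pxy.
Qed.

Lemma marg_ge0 (Y : countType) (p : X -> Y) (u : dist R X) y : 0 <= marg p u y.
Proof. by apply: fine_ge0; apply: esum_ge0 => x _; rewrite lee_fin mass_ge0. Qed.

Lemma marg_nnsummable (Y : countType) (p : X -> Y) (u : dist R X) : nnsummable (marg p u).
Proof.
split; first exact: marg_ge0.
by rewrite marg_fiber preimage_setT mass_sum1 ltry.
Qed.

Lemma dist_le_marg (Y : countType) (p : X -> Y) (u : dist R X) x :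
  u x <= marg p u (p x).
Proof.
have u0 z : (0 <= (u z)%:E)%E by rewrite lee_fin mass_ge0.
rewrite -lee_fin -(@esum_set1 _ _ (p x) (fun y => (marg p u y)%:E)) ?lee_fin ?marg_ge0//.
rewrite marg_fiber -(@esum_set1 _ _ x (fun x => (u x)%:E))//.
rewrite esum_mkcond [leRHS]esum_mkcond; apply: le_esum => z _.
by case: ifPn => [|_]; [rewrite inE => ->; rewrite ifT// inE|case: ifP].
Qed.

(** Marginals compose: summing a marginal over the coordinates forgotten by [q]
    gives the coarser marginal.  The set of these coordinates is given by an
    injective parametrization [e] of the fibre of [q] over [z]. *)
Lemma marg_comp (Y Z : countType) (p : X -> Y) (q : Y -> Z) (u : dist R X) z
    (W : choiceType) (e : W -> Y) :
  injective e -> range e = q @^-1` [set z] ->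
  nnsummable (fun w => marg p u (e w)) /\
  tsum (fun w => marg p u (e w)) = marg (q \o p) u z.
Proof.
move=> einj rg.
have E : (\esum_(w in [set: W]) (marg p u (e w))%:E =
         \esum_(x in (q \o p) @^-1` [set z]) (u x)%:E)%E.
  rewrite -(@esum_image _ _ _ _ e (fun y => (marg p u y)%:E)) ?rg ?marg_fiber//.
  by move=> ? ? _ _; exact: einj.
split; last by rewrite /tsum E.
split=> [w|]; first exact: marg_ge0.
rewrite E; apply: (@le_lt_trans _ _ 1%E); last exact: ltry.
rewrite -(mass_sum1 u) esum_mkcond; apply: le_esum => x _.
by case: ifP => // _; rewrite lee_fin mass_ge0.
Qed.
End Dist.

Lemma dist_fin_sum1 (X : finType) (u : dist R X) : \sum_x u x = 1.
Proof.
apply: EFin_inj; rewrite -(mass_sum1 u) -sumEFin esum_fin// => x.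
by rewrite lee_fin mass_ge0.
Qed.

Lemma dist_fin_le1 (X : finType) (u : dist R X) x : u x <= 1.
Proof.
rewrite -(dist_fin_sum1 u) (bigD1 x)//= lerDl sumr_ge0// => *; exact: mass_ge0.
Qed.

Lemma dist_fin_exists (X : finType) (f : X -> R) :
  (forall x, 0 <= f x) -> \sum_x f x = 1 -> exists u : dist R X, u =1 f.
Proof.
move=> f0 f1; have E : (\esum_(x in [set: X]) (f x)%:E = 1)%E.
  by rewrite esum_fin ?sumEFin ?f1// => x; rewrite lee_fin.
by exists (Dist f0 E).
Qed.
End Sums.

(** * The payoff as a bilinear form *)

Section Joint.
Variables (R : realType) (K I : finType) (Z : countType).

(** When [m] is the joint law of the state and a signal, this is the joint law
    of the state and the action played under [s].  The same construction serves
    both players. *)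
Definition joint (m : K * Z -> R) (s : Z -> dist R I) (k : K) (i : I) : R :=
  tsum (fun z => m (k, z) * s z i).

Variables (m : K * Z -> R) (m_nnsummable : forall k, nnsummable (fun z => m (k, z))).

Lemma joint_nnsummable (s : Z -> dist R I) k i : nnsummable (fun z => m (k, z) * s z i).
Proof.
apply: (nnsummable_le (m_nnsummable k)) => z; case: (m_nnsummable k) => m0 _.
by rewrite mulr_ge0 ?mass_ge0//= ler_piMr ?dist_fin_le1.
Qed.

Lemma joint_ge0 (s : Z -> dist R I) k i : 0 <= joint m s k i.
Proof. by apply: tsum_ge0; case: (joint_nnsummable s k i). Qed.

Lemma joint_sum (s : Z -> dist R I) k :
  \sum_i joint m s k i = tsum (fun z => m (k, z)).
Proof.
have := @tsum_lin R Z I (fun=> 1) (fun i z => m (k, z) * s z i)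
  (fun=> ler01) (joint_nnsummable s k).
under [RHS]eq_bigr do rewrite mul1r.
move=> <-; congr tsum; apply/funext => z.
by under eq_bigr do rewrite mul1r; rewrite -mulr_sumr dist_fin_sum1 mulr1.
Qed.

Lemma joint_le (s : Z -> dist R I) k i :
  joint m s k i <= tsum (fun z => m (k, z)).
Proof.
rewrite -(joint_sum s) (bigD1 i)//= lerDl sumr_ge0// => *; exact: joint_ge0.
Qed.

(** Mixing strategies signal by signal mixes the induced laws with the same
    weights, so the laws that a player can induce form a convex set. *)
Lemma joint_mix (Q : finType) (w : Q -> R) (s : Q -> Z -> dist R I) :
  (forall q, 0 <= w q) -> \sum_q w q = 1 ->
  exists s' : Z -> dist R I, forall k i,
    joint m s' k i = \sum_q w q * joint m (s q) k i.
Proof.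
move=> w0 w1.
have mixz z : exists d : dist R I, d =1 (fun i => \sum_q w q * s q z i).
  apply: dist_fin_exists => [i|].
    by apply: sumr_ge0 => q _; rewrite mulr_ge0 ?mass_ge0.
  rewrite exchange_big/= -w1; apply: eq_bigr => q _.
  by rewrite -mulr_sumr dist_fin_sum1 mulr1.
have [s' s'E] := choice mixz; exists s' => k i.
rewrite -tsum_lin//; last by move=> q; exact: joint_nnsummable.
congr tsum; apply/funext => z; rewrite s'E mulr_sumr.
by apply: eq_bigr => q _; rewrite mulrCA.
Qed.

End Joint.

Section Payoff.
Variables (R : realType) (K : finType) (C D : countType).

Lemma esum_state (a : K -> R) (f : K -> C -> R) (h : K -> D -> R) :
  (forall k, 0 <= a k) -> (forall k, nnsummable (f k)) -> (forall k, nnsummable (h k)) ->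
  (\esum_(w in [set: K * C * D])
      (a w.1.1 * (f w.1.1 w.1.2 * h w.1.1 w.2))%:E =
   (\sum_k a k * (tsum (f k) * tsum (h k)))%:E)%E.
Proof.
move=> a0 fs hs; have f0 k c : 0 <= f k c by case: (fs k).
have h0 k d : 0 <= h k d by case: (hs k).
have inn k : (\esum_(z in [set: C * D]) (a k * (f k z.1 * h k z.2))%:E =
    (a k * (tsum (f k) * tsum (h k)))%:E)%E.
  under eq_esum do rewrite EFinM.
  by rewrite esum_mull ?esum_mul// => z; rewrite lee_fin mulr_ge0.
rewrite -sumEFin -(@esum_fin _ K (fun k => (a k * (tsum (f k) * tsum (h k)))%:E)).
  under [RHS]eq_esum do rewrite -inn.
  rewrite esum_esum => [|k z _ _]; last by rewrite lee_fin !mulr_ge0.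
  apply/esym/(@reindex_esum _ _ _ _ _ (fun w : K * C * D => (w.1.1, (w.1.2, w.2)))
    (fun x => (a x.1 * (f x.1 x.2.1 * h x.1 x.2.2))%:E)).
  by split=> [//|[[k c] d] [[k' c'] d'] _ _ [-> -> ->]//|[k [c d]] _]; exists (k, c, d).
by move=> k; rewrite lee_fin !mulr_ge0 ?tsum_ge0.
Qed.

Variable u : info_structure R K C D.

Lemma margKC_nnsummable k : nnsummable (fun c => margKC u (k, c)).
Proof.
have := @marg_comp R _ _ K (fun w : K * C * D => w.1) fst u k C (pair k).
case=> //; first by move=> c c' [].
by apply/seteqP; split=> [_ [c _ <-]//|[k' c] /= ->]; exists c.
Qed.

Lemma margKD_margK k :
  nnsummable (fun d => margKD u (k, d)) /\ tsum (fun d => margKD u (k, d)) = margK u k.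
Proof.
apply: (@marg_comp R _ _ K (fun w : K * C * D => (w.1.1, w.2)) fst u k D (pair k)).
  by move=> d d' [].
by apply/seteqP; split=> [_ [c _ <-]//|[k' c] /= ->]; exists c.
Qed.

Lemma margKD_nnsummable k : nnsummable (fun d => margKD u (k, d)).
Proof. exact: (margKD_margK k).1. Qed.

Lemma margK_le1 k : margK u k <= 1.
Proof.
have [f0 _] := marg_nnsummable (fun w : K * C * D => w.1.1) u.
have <- : \sum_k margK u k = 1.
  apply: EFin_inj; rewrite -sumEFin -esum_fin; last exact: f0.
  by rewrite marg_fiber preimage_setT mass_sum1.
rewrite (bigD1 k)//= lerDl sumr_ge0// => *; exact: f0.
Qed.

Hypothesis u_ci : cond_indep u.

(** This form also covers states of probability 0: there [u (k, c, d)] is 0, and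
    so is the right-hand side, since 0^-1 is 0. *)
Lemma cond_indepE k c d :
  u (k, c, d) = (margK u k)^-1 * (margKC u (k, c) * margKD u (k, d)).
Proof.
have := marg_ge0 (fun w : K * C * D => w.1.1) u k; rewrite le_eqVlt.
case/orP=> [/eqP p0|p0].
  have := @dist_le_marg _ _ _ (fun w : K * C * D => w.1.1) u (k, c, d).
  rewrite /= -p0 /margK -p0 invr0 mul0r => u0.
  by apply/eqP; rewrite eq_le u0 mass_ge0.
have := u_ci p0 c d; move: p0; rewrite -/(margK u k); set p := margK u k => p0 E.
by rewrite -[LHS](divfK (lt0r_neq0 p0)) E; field; exact: lt0r_neq0.
Qed.

Variables (I J : finType).

Let bilin (g : K -> I -> J -> R) (s : C -> dist R I) (t : D -> dist R J) :=
  \sum_k \sum_i \sum_j g k i j * (margK u k)^-1 *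
    joint (margKC u) s k i * joint (margKD u) t k j.

Lemma esum_payoff (g : K -> I -> J -> R) (s : C -> dist R I) (t : D -> dist R J) :
  (forall k i j, 0 <= g k i j) ->
  (\esum_(w in [set: K * C * D])
     (u w * \sum_i \sum_j s w.1.2 i * t w.2 j * g w.1.1 i j)%:E =
   (bilin g s t)%:E)%E.
Proof.
move=> g0; have pV k : 0 <= (margK u k)^-1 by rewrite invr_ge0; exact: marg_ge0.
transitivity (\esum_(w in [set: K * C * D]) \sum_(q : I * J)
   ((g w.1.1 q.1 q.2 * (margK u w.1.1)^-1) * ((margKC u (w.1.1, w.1.2) * s w.1.2 q.1) *
     (margKD u (w.1.1, w.2) * t w.2 q.2)))%:E)%E.
  apply: eq_esum => -[[k c] d] _ /=; rewrite sumEFin cond_indepE pair_big/= mulr_sumr.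
  by congr EFin; apply: eq_bigr => q _; ring.
rewrite esum_sum => [|w q _ _]; last first.
  by rewrite lee_fin !mulr_ge0 ?mass_ge0//; exact: marg_ge0.
rewrite /bilin; under eq_bigr => q _.
  rewrite (@esum_state (fun k => g k q.1 q.2 * (margK u k)^-1)
    (fun k c => margKC u (k, c) * s c q.1) (fun k d => margKD u (k, d) * t d q.2)).
  over.
  by move=> k; rewrite mulr_ge0.
  by move=> k; apply: joint_nnsummable; exact: margKC_nnsummable.
  by move=> k; apply: joint_nnsummable; exact: margKD_nnsummable.
rewrite sumEFin exchange_big/=; congr EFin; apply: eq_bigr => k _.
by rewrite pair_big; apply: eq_bigr => q _ /=; rewrite !mulrA.
Qed.

(** The payoff depends on the strategies only through the laws of state and
    action, and is bilinear in them.  The formula is a rearrangement of sums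
    for nonnegative payoffs; the general case writes [g] as (g + |g|) - |g|. *)
Lemma exp_payoffE (g : K -> I -> J -> R) (s : C -> dist R I) (t : D -> dist R J) :
  exp_payoff u g s t = \sum_k \sum_i \sum_j g k i j * (margK u k)^-1 *
    joint (margKC u) s k i * joint (margKD u) t k j.
Proof.
pose g1 k i j := g k i j + `|g k i j|; pose g2 k i j := `|g k i j|.
have g10 k i j : 0 <= g1 k i j.
  by have := ler_norm (- g k i j); rewrite normrN /g1; lra.
have g20 k i j : 0 <= g2 k i j by rewrite /g2.
pose F (h : K -> I -> J -> R) w := (u w * \sum_i \sum_j s w.1.2 i * t w.2 j * h w.1.1 i j)%:E.
have F0 h : (forall k i j, 0 <= h k i j) -> forall w, (0 <= F h w)%E.
  move=> h0 w; rewrite lee_fin mulr_ge0 ?mass_ge0// !sumr_ge0// => i _.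
  by rewrite sumr_ge0// => j _; rewrite !mulr_ge0 ?mass_ge0.
have Fs h : (forall k i j, 0 <= h k i j) -> summable setT (F h).
  move=> h0; rewrite /summable; under eq_esum do rewrite gee0_abs ?F0//.
  by rewrite esum_payoff ?ltry.
rewrite /exp_payoff /expect.
have -> : (fun w => (u w * \sum_i \sum_j s w.1.2 i * t w.2 j * g w.1.1 i j)%:E) =
    (F g1 \- F g2)%E.
  apply/funext => w; rewrite /F /= -EFinB -mulrBr -sumrB; congr (_ * _)%:E.
  apply: eq_bigr => i _; rewrite -sumrB; apply: eq_bigr => j _.
  by rewrite /g1 /g2 -mulrBr addrK.
rewrite esumB//; [|exact: Fs|exact: Fs|by move=> w _; exact: F0|by move=> w _; exact: F0].
rewrite !esum_payoff// -EFinB /= /bilin -sumrB; apply: eq_bigr => k _.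
rewrite -sumrB; apply: eq_bigr => i _; rewrite -sumrB; apply: eq_bigr => j _.
by rewrite /g1 /g2; ring.
Qed.

End Payoff.

(** * Minimax for bounded convex sets in finite dimension *)

Section Minimax.
Variables (R : realType) (Y : finType) (A B : Type).

Definition convex_family (T : Type) (a : T -> Y -> R) :=
  forall (Q : finType) (w : Q -> R) (s : Q -> T),
    (forall q, 0 <= w q) -> \sum_q w q = 1 ->
    exists s', forall y, a s' y = \sum_q w q * a (s q) y.

Definition dot (x y : Y -> R) := \sum_z x z * y z.

Lemma dot_sumr (Q : finType) (w : Q -> R) (x : Y -> R) (y : Q -> Y -> R) z :
  (forall i, z i = \sum_q w q * y q i) -> dot x z = \sum_q w q * dot x (y q).
Proof.
move=> zE; rewrite /dot; under eq_bigr do rewrite zE mulr_sumr.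
rewrite exchange_big/=; apply: eq_bigr => q _; rewrite mulr_sumr.
by apply: eq_bigr => i _; rewrite mulrCA.
Qed.

Lemma dotC x y : dot x y = dot y x.
Proof. by apply: eq_bigr => i _; rewrite mulrC. Qed.

Variables (a : A -> Y -> R) (b : B -> Y -> R).
Hypothesis a_conv : convex_family a.
Hypothesis b_conv : convex_family b.

(** As [l] tends to 0 the hypothesis reads 2 x <= l (x + L). *)
Lemma penalty_vanish (L : R) (x : R) : 0 <= L -> 0 <= x ->
  (forall l, 0 <= l <= 1 -> x <= (1 - l) ^+ 2 * x + l ^+ 2 * L) -> x = 0.
Proof.
move=> L0 x0 H; apply/eqP; rewrite eq_le x0 andbT.
have [//|xp] := leP x 0.
(* Any [l] with l (x + L) < 2 x gives a contradiction. *)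
pose l := x / (x + L).
have xL : 0 < x + L by lra.
have l0 : 0 < l by rewrite divr_gt0.
have l1 : l <= 1 by rewrite ler_pdivrMr// mul1r lerDl.
have lE : l * (x + L) = x by rewrite mulrAC -mulrA divff ?mulr1 ?gt_eqF.
have := H l; rewrite (ltW l0) l1 => /(_ isT) Hl.
have : 0 <= l * (l * (x + L) - 2 * x) by lra.
rewrite pmulr_rge0// lE; lra.
Qed.

(** Measure a strategy [s] by [phi s], the sum over [q] of the squares of its
    positive shortfalls [w s q] below [v].  The mixture of the [tq q] with
    weights proportional to [w s] has a reply [s'] worth at least [v], that is,
    with nonpositive correlation between [w s] and the shortfalls of [s'].
    Moving from [s] to (1 - l) s + l s' therefore multiplies [phi] by
    (1 - l)^2 up to a term of order l^2, so that [phi] has infimum 0.  No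
    compactness is used, which is why [e] cannot be dropped. *)
Lemma maxmin_finite (Q : finType) (tq : Q -> B) (v M : R) :
  inhabited A ->
  (forall s q, `|dot (a s) (b (tq q))| <= M) ->
  (forall t, exists s, v <= dot (a s) (b t)) ->
  forall e, 0 < e -> exists s, forall q, v - e <= dot (a s) (b (tq q)).
Proof.
move=> [s0] PM Hv e e0.
pose P s q := dot (a s) (b (tq q)).
pose w s q := Num.max 0 (v - P s q).
pose phi s := \sum_q w s q ^+ 2.
have w0 s q : 0 <= w s q by rewrite le_max lexx.
have wge s q : v - P s q <= w s q by rewrite le_max lexx orbT.
have phi0 s : 0 <= phi s by apply: sumr_ge0 => q _; rewrite sqr_ge0.
pose E := range phi.
have E0 : E !=set0 by exists (phi s0), s0.
have Elb : has_lbound E by exists 0 => _ [s _ <-].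
pose L := \sum_(q : Q) (`|v| + M) ^+ 2.
have L0 : 0 <= L by apply: sumr_ge0 => q _; rewrite sqr_ge0.
have Yb s : \sum_q (v - P s q) ^+ 2 <= L.
  apply: ler_sum => q _; rewrite -ler_sqrt ?sqr_ge0// !sqrtr_sqr.
  rewrite [leRHS]ger0_norm; last by rewrite addr_ge0// (le_trans _ (PM s q)).
  by rewrite (le_trans (ler_normB _ _))// lerD2l; exact: PM.
have step s l : 0 <= l <= 1 -> inf E <= (1 - l) ^+ 2 * phi s + l ^+ 2 * L.
  move=> /andP[l0 l1].
  (* When [s] has no shortfall there are no weights to normalize, and any [s'] does. *)
  have [s' s'E] : exists s', \sum_q w s q * (v - P s' q) <= 0.
    have [W0|W0] := eqVneq (\sum_q w s q) 0.
      exists s0; rewrite big1// => q _.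
      have /psumr_eq0P := W0; move=> /(_ (fun q _ => w0 s q)) ->//.
      by rewrite mul0r.
    have Wp : 0 < \sum_q w s q by rewrite lt_neqAle eq_sym W0 sumr_ge0.
    have [||t tE] := b_conv (w := fun q => w s q / \sum_q w s q) tq.
    - by move=> q; rewrite divr_ge0// ltW.
    - by rewrite -mulr_suml divff.
    have [s' Hs'] := Hv t; exists s'.
    rewrite (dot_sumr _ tE) in Hs'.
    under eq_bigr do rewrite mulrBr; rewrite sumrB -mulr_suml subr_le0.
    move: Hs'; under eq_bigr do rewrite mulrAC.
    by rewrite -mulr_suml ler_pdivlMr// mulrC.
  have [||s2 s2E] := a_conv (w := fun i : bool => if i then l else 1 - l)
     (fun i : bool => if i then s' else s).
  - by case; rewrite ?subr_ge0.
  - by rewrite big_bool/=; lra.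
  have P2 q : v - P s2 q = (1 - l) * (v - P s q) + l * (v - P s' q).
    rewrite /P dotC (dot_sumr _ s2E) big_bool/= !(dotC (b _)); ring.
  apply: (@le_trans _ _ (phi s2)); first by apply: ge_inf => //; exists s2.
  (* The positive part of a sum is bounded by replacing one term by its positive
     part; this makes the bound a square that can be expanded. *)
  have : phi s2 <= \sum_q ((1 - l) * w s q + l * (v - P s' q)) ^+ 2.
    apply: ler_sum => q _; rewrite {1}/w P2.
    set x := v - P s q; set y := v - P s' q.
    have lx : (1 - l) * x <= (1 - l) * w s q by rewrite ler_wpM2l ?subr_ge0//; exact: wge.
    have [z0|z0] := leP ((1 - l) * x + l * y) 0.
      by rewrite expr0n sqr_ge0.
    rewrite ler_sqr ?nnegrE; lra.
  move=> /le_trans; apply.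
  have -> : \sum_q ((1 - l) * w s q + l * (v - P s' q)) ^+ 2 =
     (1 - l) ^+ 2 * phi s + (2 * l * (1 - l)) * (\sum_q w s q * (v - P s' q))
      + l ^+ 2 * \sum_q (v - P s' q) ^+ 2.
    rewrite /phi !mulr_sumr -!big_split/=; apply: eq_bigr => q _; ring.
  rewrite lerD// ?ler_wpM2l ?sqr_ge0// gerDl mulr_ge0_le0// !mulr_ge0// subr_ge0//.
have infE : inf E = 0.
  apply: (penalty_vanish L0); first by apply: lb_le_inf => // _ [s _ <-].
  move=> l l01; apply/ler_addgt0Pr => d d0.
  have [_ [s _ <-] sd] := inf_adherent d0 (conj E0 Elb).
  apply: le_trans (step s l l01) _.
  rewrite addrAC lerD2r.
  have c1 : (1 - l) ^+ 2 <= 1 by case/andP: l01 => ? ?; rewrite expr_le1//; lra.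
  apply: (@le_trans _ _ ((1 - l) ^+ 2 * (inf E + d))).
    by rewrite ler_wpM2l ?sqr_ge0// ltW.
  by rewrite mulrDr lerD2l ler_piMl// ltW.
have e20 : 0 < e ^+ 2 by rewrite exprn_gt0.
have [_ [s _ <-]] := inf_adherent e20 (conj E0 Elb).
rewrite infE add0r => phis; exists s => q.
rewrite lerBlDr -lerBlDl; apply: le_trans (wge s q) _.
rewrite -ler_sqr ?nnegrE//; last exact: ltW.
apply: le_trans (ltW phis); rewrite /phi (bigD1 q)//= lerDl.
by apply: sumr_ge0 => *; rewrite sqr_ge0.
Qed.

(** Cut the cube [0, 1]^Y into finitely many cells of side [e], and choose one
    strategy in each cell that meets the family. *)
Lemma finite_net (e : R) : 0 < e -> inhabited B ->
  (forall t y, 0 <= b t y <= 1) ->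
  exists (Q : finType) (tq : Q -> B), forall t, exists q, forall y,
    `|b t y - b (tq q) y| <= e.
Proof.
move=> e0 [t0] b01.
pose N := Num.truncn e^-1.
pose cell t : {ffun Y -> 'I_N.+2} := [ffun y => inord (Num.truncn (b t y / e))].
have cellE t y : (cell t y : nat) = Num.truncn (b t y / e).
  rewrite ffunE inordK// ltnS leqW//; apply: Num.Theory.le_truncn.
  by have /andP[? ?] := b01 t y; rewrite ler_piMl// invr_ge0 ltW.
have repr q : exists t, (exists t', cell t' = q) -> cell t = q.
  have [[t tq]|nq] := pselect (exists t, cell t = q); first by exists t.
  by exists t0 => /nq.
have [tq tqP] := choice repr.
have tqE t : cell (tq (cell t)) = cell t by apply: tqP; exists t.
exists {ffun Y -> 'I_N.+2}, tq => t; exists (cell t) => y.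
have := cellE t y; rewrite -[in LHS]tqE cellE.
have h t' : (Num.truncn (b t' y / e))%:R * e <= b t' y < ((Num.truncn (b t' y / e))%:R + 1) * e.
  rewrite -ler_pdivlMr// -ltr_pdivrMr// natr1.
  by apply: truncn_itv; have /andP[? _] := b01 t' y; rewrite divr_ge0// ltW.
move: (h t) (h (tq (cell t))) => + + E; rewrite E.
set z := _%:R; move=> /andP[? ?] /andP[? ?].
by rewrite ler_norml; apply/andP; split; lra.
Qed.

(** The value in terms of [e]-optimal strategies: the sets of laws need not be
    closed, so optimal strategies need not exist. *)
Definition saddle_value (P : A -> B -> R) (x : R) :=
  (forall e : R, 0 < e -> exists s, forall t, x - e <= P s t) /\
  (forall e : R, 0 < e -> exists t, forall s, P s t <= x + e).

(** The candidate is the maxmin.  If it were below the minmax by more than [e],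
    every [t] would have a reply better than it by [e]; [maxmin_finite] on a net
    fine enough that payoffs vary by at most [e / 4] within a cell would give one
    [s] guaranteeing [e / 2] more than the maxmin. *)
Theorem minimax (m : Y -> R) : inhabited A -> inhabited B ->
  (forall s y, `|a s y| <= m y) -> (forall t y, 0 <= b t y <= 1) ->
  exists x, saddle_value (fun s t => dot (a s) (b t)) x.
Proof.
move=> iA iB am b01; pose P s t := dot (a s) (b t).
have [s0] := iA; have [t0] := iB.
pose M := \sum_y m y.
have m0 y : 0 <= m y by apply: le_trans (am s0 y).
have M0 : 0 <= M by exact: sumr_ge0.
have PL s (x y : Y -> R) (e : R) : (forall z, `|x z - y z| <= e) ->
    `|dot (a s) x - dot (a s) y| <= M * e.
  move=> xy; rewrite /dot -sumrB mulr_suml.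
  apply: le_trans (ler_norm_sum _ _ _) _; apply: ler_sum => z _.
  by rewrite -mulrBr normrM ler_pM.
have PM s t : `|P s t| <= M.
  have := PL s (b t) (fun=> 0) 1; rewrite mulr1.
  have -> : dot (a s) (fun=> 0) = 0 by apply: big1 => z _; rewrite mulr0.
  by rewrite subr0; apply => z; rewrite subr0 ger0_norm; case/andP: (b01 t z).
pose E := [set x : R | exists s, forall t, x <= P s t].
have Esup : has_sup E.
  split; first by exists (- M), s0 => t; have /ler_normlP[] := PM s0 t; lra.
  exists M => x [s /(_ t0)] /le_trans; apply; exact: le_trans (ler_norm _) (PM s t0).
exists (sup E); split=> e e0.
  have [x [s sx] xe] := sup_adherent e0 Esup; exists s => t.
  exact: le_trans (ltW xe) (sx t).
apply: contrapT => /forallNP noT.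
have bestS t : exists s, sup E + e <= P s t.
  have /existsNP[s /negP] := noT t; rewrite -ltNge => h; exists s; exact: ltW.
(* [M] may be 0, hence the denominator [M + 1]. *)
have e10 : 0 < e / 4 / (M + 1) by rewrite !divr_gt0//; lra.
have [Q [tq net]] := finite_net e10 iB b01.
have e40 : 0 < e / 4 by lra.
have [s Hs] := maxmin_finite iA (fun s q => PM s (tq q)) bestS e40.
have : sup E + e / 2 <= sup E.
  apply: ub_le_sup; first by case: Esup.
  exists s => t; have [q qt] := net t.
  have le4 : M * (e / 4 / (M + 1)) <= e / 4.
    by rewrite mulrCA ler_piMr ?(ltW e40)// ler_pdivrMr//; lra.
  have h1 : sup E + e - e / 4 <= P s (tq q) := Hs q.
  have : `|P s t - P s (tq q)| <= e / 4 := le_trans (PL s _ _ _ qt) le4.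
  by rewrite ler_norml => /andP[]; lra.
lra.
Qed.
End Minimax.

(** * Values, and reduction to single-agent problems *)

Section Game.
Variables (R : realType) (K : finType) (C D : countType).
Implicit Types u v : info_structure R K C D.

Lemma value_saddle (I J : finType) u (g : K -> I -> J -> R) x :
  saddle_value (exp_payoff u g) x -> value u g = x.
Proof.
move=> [hs ht].
have lo : (x%:E <= maxmin u g)%E.
  apply/lee_addgt0Pr => e e0; have [s Hs] := hs e e0.
  rewrite -leeBlDr// -EFinB.
  apply: le_trans (ereal_sup_ubound _); last by exists s.
  by apply: le_ereal_inf_tmp => _ [t _ <-]; rewrite lee_fin.
have hi : (minmax u g <= x%:E)%E.
  apply/lee_addgt0Pr => e e0; have [t Ht] := ht e e0.
  rewrite -EFinD.
  apply: le_trans (ereal_inf_lbound _) _; first by exists t.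
  by apply: ge_ereal_sup => _ [s _ <-]; rewrite lee_fin.
have weak : (maxmin u g <= minmax u g)%E.
  apply: ge_ereal_sup => _ [s _ <-]; apply: le_ereal_inf_tmp => _ [t _ <-].
  apply: (@le_trans _ _ (exp_payoff u g s t)%:E).
    by apply: ereal_inf_lbound; exists t.
  by apply: ereal_sup_ubound; exists s.
have E1 : maxmin u g = x%:E by apply/eqP; rewrite eq_le lo (le_trans weak hi).
have E2 : minmax u g = x%:E by apply/eqP; rewrite eq_le hi (le_trans lo weak).
have [] : [set y : R | maxmin u g = y%:E /\ minmax u g = y%:E] (value u g).
  by apply: xgetPex; exists x.
by rewrite E1 => -[].
Qed.

Lemma strategy_exists (Z : Type) (I : finType) :
  (0 < #|I|)%N -> inhabited (Z -> dist R I).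
Proof.
move=> /card_gt0P[i _].
have [||d _] := @dist_fin_exists R I (fun i' => (i' == i)%:R).
- by [].
- by rewrite (bigD1 i)//= eqxx big1 ?addr0// => j /negbTE ->.
exact: (inhabits (fun=> d)).
Qed.

(** [minimax] applies to vectors indexed by [K * J]: player 2 contributes the
    law of state and action, player 1 the payoff that each state-action pair of
    player 2 yields per unit of probability. *)
Lemma value_exists (I J : finType) u (g : K -> I -> J -> R) :
  cond_indep u -> (0 < #|I|)%N -> (0 < #|J|)%N ->
  saddle_value (exp_payoff u g) (value u g).
Proof.
move=> ui I0 J0; have S1 := margKC_nnsummable u; have S2 := margKD_nnsummable u.
pose c (y : K * J) i := g y.1 i y.2 * (margK u y.1)^-1.
pose a s (y : K * J) := \sum_i c y i * joint (margKC u) s y.1 i.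
pose b t (y : K * J) := joint (margKD u) t y.1 y.2.
have PE s t : exp_payoff u g s t = dot (a s) (b t).
  rewrite exp_payoffE// /dot /a /b -(pair_bigA _ (fun k j =>
    (\sum_i g k i j * (margK u k)^-1 * joint (margKC u) s k i) * joint (margKD u) t k j))/=.
  apply: eq_bigr => k _; rewrite exchange_big/=; apply: eq_bigr => j _.
  by rewrite mulr_suml.
have bc : convex_family b.
  move=> Q w t w0 w1; have [t' t'E] := joint_mix S2 t w0 w1.
  by exists t' => y; rewrite /b t'E.
have ac : convex_family a.
  move=> Q w s w0 w1; have [s' s'E] := joint_mix S1 s w0 w1.
  exists s' => y; rewrite /a; under eq_bigr do rewrite s'E mulr_sumr.
  rewrite exchange_big/=; apply: eq_bigr => q _; rewrite mulr_sumr.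
  by apply: eq_bigr => i _; rewrite mulrCA.
have iS := strategy_exists C I0.
have iT := strategy_exists D J0.
have [|t y|x xP] := minimax ac bc (m := fun y => \sum_i `|c y i| * tsum (fun z => margKC u (y.1, z))) iS iT.
- move=> s y; apply: le_trans (ler_norm_sum _ _ _) _; apply: ler_sum => i _.
  by rewrite normrM ler_wpM2l// ger0_norm ?joint_ge0// joint_le.
- rewrite joint_ge0//=; apply: le_trans (joint_le S2 _ _ _) _.
  by rewrite (margKD_margK u _).2 margK_le1.
have xP' : saddle_value (exp_payoff u g) x.
  case: xP => h1 h2; split=> e e0.
    by have [s Hs] := h1 e e0; exists s => t; rewrite PE.
  by have [t Ht] := h2 e e0; exists t => s; rewrite PE.
by rewrite (value_saddle xP').
Qed.

(** The single-agent problem left to player 1 by [t]: conditional on [k],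
    player 2 plays [j] with probability [joint (margKD u) t k j / margK u k]. *)
Definition reduced (I J : finType) u (g : K -> I -> J -> R)
    (t : D -> dist R J) (k : K) (i : I) (_ : unit) : R :=
  \sum_j g k i j * (margK u k)^-1 * joint (margKD u) t k j.

(** The strategy [t'] is that of the dummy player 2, who has one action. *)
Lemma reduced_payoff (I J : finType) u (g : K -> I -> J -> R) s t t' :
  cond_indep u ->
  exp_payoff u (reduced u g t) s t' = exp_payoff u g s t.
Proof.
move=> ui; rewrite !exp_payoffE//.
apply: eq_bigr => k _; apply: eq_bigr => i _.
have S2 := margKD_nnsummable u.
have U1 (f : unit -> R) : \sum_z f z = f tt by rewrite (big_pred1 tt)// => -[].
have := joint_sum S2 t' k; rewrite !U1 (margKD_margK u k).2 => ->.
rewrite /reduced; have [->|p0] := eqVneq (margK u k) 0.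
  by rewrite mulr0; under eq_bigr do rewrite invr0 mulr0 !mul0r; rewrite big1.
rewrite mulrAC divfK// mulr_suml; by apply: eq_bigr => j _; rewrite mulrAC.
Qed.

Lemma reduced_payoffs1 (I J : finType) u (g : K -> I -> J -> R) t :
  payoffs g -> payoffs1 (reduced u g t).
Proof.
move=> [I0 J0 g1]; split; last by rewrite card_unit.
split=> // [|k i z]; first by rewrite card_unit.
have S2 := margKD_nnsummable u.
have p0 : 0 <= (margK u k)^-1 by rewrite invr_ge0; exact: marg_ge0.
rewrite -ler_norml; apply: le_trans (ler_norm_sum _ _ _) _.
apply: (@le_trans _ _ (\sum_j (margK u k)^-1 * joint (margKD u) t k j)).
  apply: ler_sum => j _; rewrite !normrM (ger0_norm p0) (ger0_norm (joint_ge0 S2 _ _ _)).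
  by rewrite -mulrA ler_piMl ?mulr_ge0 ?joint_ge0// ler_norml.
rewrite -mulr_sumr joint_sum// (margKD_margK u k).2.
by have [->|h] := eqVneq (margK u k) 0; [rewrite mulr0|rewrite mulVf].
Qed.

Lemma reduced_eq (I J : finType) u v (g : K -> I -> J -> R) t :
  margKD u =1 margKD v -> reduced u g t = reduced v g t.
Proof.
move=> /funext uv; apply/funext => k; apply/funext => i; apply/funext => z.
by rewrite /reduced -!(margKD_margK _ k).2 uv.
Qed.

(** Let [t] be nearly optimal for player 2 in the game under [v].  Up to a small
    error, the problem [G_t] is worth at most [value v g] under [v], so at most
    [value v g + r] under [u]; but under [u] it is worth at least [value u g],
    which player 1 can guarantee against every [t]. *)
Lemma value_le (I J : finType) u v (g : K -> I -> J -> R) r :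
  cond_indep u -> cond_indep v -> margKD u =1 margKD v -> payoffs g ->
  (forall h : K -> I -> unit -> R, payoffs1 h ->
     `|value u h - value v h| <= r) ->
  value u g <= value v g + r.
Proof.
move=> ui vi uv pg d1; have [I0 J0 _] := pg.
apply/ler_addgt0Pr => e e0; have e20 : 0 < e / 4 by lra.
have [_ /(_ _ e20)[t tP]] := value_exists g vi I0 J0.
have [/(_ _ e20)[s sP] _] := value_exists g ui I0 J0.
have h1 := reduced_payoffs1 u t pg.
have [[_ U1 _] _] := h1.
have Ev : value v (reduced u g t) <= value v g + e / 4 + e / 4.
  have [/(_ _ e20)[s' s'P] _] := value_exists (reduced u g t) vi I0 U1.
  have [t'] := strategy_exists D U1.
  have := s'P t'; rewrite (reduced_eq _ _ uv) reduced_payoff//.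
  have := tP s'; rewrite -(reduced_eq _ _ uv); lra.
have Eu : exp_payoff u g s t <= value u (reduced u g t) + e / 4.
  have [_ /(_ _ e20)[t' t'P]] := value_exists (reduced u g t) ui I0 U1.
  by have := t'P s; rewrite reduced_payoff.
have := d1 _ h1; rewrite ler_norml => /andP[_].
have := sP t; lra.
Qed.
End Game.

Theorem proposition2 (R : realType) (K : finType) (C D : countType)
    (hK : (2 <= #|K|)%N) (hC : inhabited C) (hD : inhabited D)
    (u v : info_structure R K C D)
    (hu : cond_indep u) (hv : cond_indep v)
    (huv : margKD u =1 margKD v) :
  d_val u v = d1_val u v.
Proof.
apply/eqP; rewrite eq_le; apply/andP; split; last first.
  apply: ereal_sup_le => _ [I [J [g [[pg _] ->]]]]; by exists I, J, g.
apply: ge_ereal_sup => _ [I [J [g [pg ->]]]].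
have ub (I' J' : finType) (h : K -> I' -> J' -> R) : payoffs1 h ->
    (`|value u h - value v h|%:E <= d1_val u v)%E.
  by move=> ph; apply: ereal_sup_ubound; exists I', J', h.
case E : (d1_val u v) => [r| |]; last 2 first.
- exact: leey.
- have [I0 J0 _] := pg; have [t] := strategy_exists R D J0.
  (* A supremum is -oo only over the empty set, and [G_t] is in this one. *)
  by have := ub _ _ _ (reduced_payoffs1 u t pg); rewrite E.
have ubr (h : K -> I -> unit -> R) : payoffs1 h -> `|value u h - value v h| <= r.
  by move=> ph; rewrite -lee_fin -E; exact: ub.
have uv := value_le hu hv huv pg ubr.
have vu : value v g <= value u g + r.
  by apply: value_le => // h ph; rewrite distrC; exact: ubr.
by rewrite lee_fin ler_norml; apply/andP; split; lra.
Qed.
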